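(* Let $k\ge 2$ and let $V=\{v_1,\dots,v_n\}$ be partitioned into clusters $\mathcal C_1,\dots,\mathcal C_k$ all of the same size $|\mathcal C|\ge 2$. For parameters $p_{\mathrm{in}}^+,p_{\mathrm{out}}^+,p_{\mathrm{in}}^-,p_{\mathrm{out}}^-\in[0,1]$ consider the expected graphs of the signed stochastic block model and the associated matrices $\mathcal L_{GM},\mathcal L_{SN},\mathcal L_{BN}$. Let $\boldsymbol\chi_1=\mathbf 1$ and $\boldsymbol\chi_i=(k-1)\mathbf 1_{\mathcal C_i}-\mathbf 1_{\overline{\mathcal C_i}}$ for $i=2,\dots,k$. Assume that $p_{\mathrm{out}}^+<p_{\mathrm{in}}^+$ and $p_{\mathrm{in}}^-<p_{\mathrm{out}}^-$. Then: (i) $\boldsymbol\chi_1,\dots,\boldsymbol\chi_k$ are the eigenvectors corresponding to the $k$ smallest eigenvalues of $\mathcal L_{GM}$. (ii) Let $p(k)$ denote the proportion of cases, among parameters satisfying $p_{\mathrm{out}}^+<p_{\mathrm{in}}^+$ and $p_{\mathrm{in}}^-<p_{\mathrm{out}}^-$, in which $\boldsymbol\chi_1,\dots,\boldsymbol\chi_k$ are the eigenvectors corresponding to the $k$ smallest eigenvalues of $\mathcal L_{SN}$ or of $\mathcal L_{BN}$; that is, $p(k)$ is the conditional probability of this event given $\{p_{\mathrm{out}}^+<p_{\mathrm{in}}^+\}\cap\{p_{\mathrm{in}}^-<p_{\mathrm{out}}^-\}$ when $(p_{\mathrm{in}}^+,p_{\mathrm{out}}^+,p_{\mathrm{in}}^-,p_{\mathrm{out}}^-)$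 is uniformly distributed on $[0,1]^4$. Then $$p(k)\le\frac16+\frac{2}{3(k-1)}+\frac{1}{(k-1)^2}.$$
   Context: Expected signed stochastic block model: $\mathcal W^+$ and $\mathcal W^-$ are the $n\times n$ matrices with $\mathcal W^{+}_{ij}=p_{\mathrm{in}}^{+}$ and $\mathcal W^{-}_{ij}=p_{\mathrm{in}}^{-}$ if $v_i,v_j$ belong to the same cluster (including $i=j$), and $\mathcal W^{+}_{ij}=p_{\mathrm{out}}^{+}$, $\mathcal W^{-}_{ij}=p_{\mathrm{out}}^{-}$ if $v_i,v_j$ belong to different clusters. $\mathcal D^{\pm}$ is the diagonal matrix with $\mathcal D^{\pm}_{ii}=\sum_j\mathcal W^{\pm}_{ij}$, and $\bar{\mathcal D}=\mathcal D^++\mathcal D^-$. Put $$\mathcal L_{BN}=\bar{\mathcal D}^{-1}(\mathcal D^+-\mathcal W^++\mathcal W^-),\qquad \mathcal L_{SN}=\bar{\mathcal D}^{-1/2}(\bar{\mathcal D}-\mathcal W^++\mathcal W^-)\bar{\mathcal D}^{-1/2},$$ $$\mathcal L_{\mathrm{sym}}^+=(\mathcal D^+)^{-1/2}(\mathcal D^+-\mathcal W^+)(\mathcal D^+)^{-1/2},\quad \mathcal Q_{\mathrm{sym}}^-=(\mathcal D^-)^{-1/2}(\mathcal D^-+\mathcal W^-)(\mathcal D^-)^{-1/2},\quad \mathcal L_{GM}=\mathcal L_{\mathrm{sym}}^+\#\mathcal Q_{\mathrm{sym}}^-.$$ (All degrees are positive under the assumed inequalities. Since all clusters have equal size, the degree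 matrices are multiples of the identity, so all these matrices are symmetric.) Geometric mean: for symmetric positive definite $A,B$, $A\#B=A^{1/2}(A^{-1/2}BA^{-1/2})^{1/2}A^{1/2}$, where $X^{1/2}$ is the unique positive definite square root. For positive semidefinite $A,B$ (as is the case here), $A\#B=\lim_{\varepsilon\downarrow0}(A+\varepsilon I)\#(B+\varepsilon I)$; when $A$ and $B$ commute this equals the positive semidefinite square root of $AB$. Notation: $\mathbf 1\in\mathbb R^n$ is the all-ones vector, $\mathbf 1_S$ is the indicator vector of $S\subseteq V$, and $\overline{S}=V\setminus S$. Convention: for a symmetric matrix $M\in\mathbb R^{n\times n}$, ''$\boldsymbol\chi_1,\dots,\boldsymbol\chi_k$ are the eigenvectors corresponding to the $k$ smallest eigenvalues of $M$'' means that each $\boldsymbol\chi_i$ is an eigenvector of $M$ and its eigenvalue is strictly smaller than each of the remaining $n-k$ eigenvalues of $M$, i.e. the eigenvalues of $M$ restricted to the orthogonal complement of $\mathrm{span}\{\boldsymbol\chi_1,\dots,\boldsymbol\chi_k\}$. *)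

(* Defs.v *)
From HB Require Import structures.
From mathcomp Require Import all_boot all_order all_algebra.
From mathcomp Require Import all_classical all_reals all_analysis.

Set Implicit Arguments.
Unset Strict Implicit.
Unset Printing Implicit Defensive.

Import Order.TTheory GRing.Theory Num.Theory.
Import numFieldNormedType.Exports.

Local Open Scope classical_set_scope.
Local Open Scope ring_scope.

Section MatrixGeometricMean.
Context {R : realType} {n : nat}.
Implicit Types A B : 'M[R]_n.

Definition posdefmx A : Prop :=
  A^T = A /\ forall x : 'cV[R]_n, x != 0 -> 0 < (x^T *m A *m x) 0 0.

(* The positive definite square root of a positive definite matrix; the value
   is the junk matrix 0 when there is none. *)
Definition sqrtmx A : 'M[R]_n := xget 0 [set B | posdefmx B /\ B *m B = A].

Definition invsqrtmx A : 'M[R]_n := invmx (sqrtmx A).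

Definition gmean_posdef A B : 'M[R]_n :=
  sqrtmx A *m sqrtmx (invsqrtmx A *m B *m invsqrtmx A) *m sqrtmx A.

(* A # B for positive semidefinite A and B; the limit is taken in the
   (entrywise) topology of 'M[R]_n, as e tends to 0 from the right. *)
Definition gmean A B : 'M[R]_n :=
  lim (gmean_posdef (A + e%:M) (B + e%:M) @[e --> 0^'+]).

End MatrixGeometricMean.

Section SmallestEigenvectors.
Context {R : realType} {n : nat}.

Definition is_eigenvector (M : 'M[R]_n) (a : R) (x : 'cV[R]_n) : Prop :=
  x != 0 /\ M *m x = a *: x.

(* The vectors chi i are linearly independent eigenvectors of M, each with an
   eigenvalue strictly below every eigenvalue of M on the orthogonal complement
   of their span.  Independence is what makes these remaining eigenvalues
   n - k in number.  The definition is meant for symmetric M. *)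
Definition smallest_eigenvectors (k : nat) (M : 'M[R]_n)
    (chi : 'I_k -> 'cV[R]_n) : Prop :=
  row_free (\matrix_(i < k) (chi i)^T) /\
  forall i : 'I_k, exists a : R, is_eigenvector M a (chi i) /\
    forall (b : R) (x : 'cV[R]_n), is_eigenvector M b x ->
      (forall j : 'I_k, (chi j)^T *m x = 0) -> a < b.

Definition indicator_col (S : {set 'I_n}) : 'cV[R]_n := \col_v (v \in S)%:R.

End SmallestEigenvectors.

(* A clustering of the vertices 'I_n into k labelled clusters is a map
   cl : 'I_n -> 'I_k; labels start at 0, so that label 0 is the first cluster. *)
Section ExpectedSSBM.
Context {R : realType} {k n : nat}.
Variable cl : 'I_n -> 'I_k.

Definition cluster_set (i : 'I_k) : {set 'I_n} := [set v | cl v == i].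

Definition chi (i : 'I_k) : 'cV[R]_n :=
  if val i == 0%N then const_mx 1
  else (k%:R - 1) *: indicator_col (cluster_set i) - indicator_col (~: cluster_set i).

Definition expected_adj (p_in p_out : R) : 'M[R]_n :=
  \matrix_(u, v) (if cl u == cl v then p_in else p_out).

Definition degree_mx (W : 'M[R]_n) : 'M[R]_n := diag_mx (\row_u \sum_v W u v).

Variables pinP poutP pinM poutM : R.

Let WP := expected_adj pinP poutP.
Let WM := expected_adj pinM poutM.
Let DP := degree_mx WP.
Let DM := degree_mx WM.
Let Dbar := DP + DM.

Definition L_BN : 'M[R]_n := invmx Dbar *m (DP - WP + WM).

Definition L_SN : 'M[R]_n :=
  invsqrtmx Dbar *m (Dbar - WP + WM) *m invsqrtmx Dbar.

Definition Lsym_plus : 'M[R]_n := invsqrtmx DP *m (DP - WP) *m invsqrtmx DP.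

Definition Qsym_minus : 'M[R]_n := invsqrtmx DM *m (DM + WM) *m invsqrtmx DM.

Definition L_GM : 'M[R]_n := gmean Lsym_plus Qsym_minus.

End ExpectedSSBM.

Section UniformParameters.
Variable R : realType.

(* Tuples (p_in^+, p_out^+, p_in^-, p_out^-), with the Borel sets of R^4. *)
Definition params : Type :=
  measurableTypeR R * measurableTypeR R * measurableTypeR R * measurableTypeR R.

Local Notation U01 := (uniform_prob (@ltr01 R)).

Definition uniform4 : probability params R := (U01 \x U01 \x U01 \x U01)%E.

Definition cond_prob d (T : measurableType d) (P : probability T R)
    (A B : set T) : R := fine (P (A `&` B)) / fine (P B).

End UniformParameters.

(* Main.v *)
Require Import Defs.
From mathcomp Require Import all_boot all_order all_algebra.
From mathcomp Require Import all_classical all_reals all_analysis.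
From mathcomp Require Import measurable_realfun ring lra.

(* All the matrices of the model lie in the commutative algebra of the matrices
   acting as a scalar on each of three orthogonal spaces: the constant vectors,
   the vectors that are constant on clusters and sum to 0, and the vectors that
   sum to 0 on every cluster.  The vectors chi_i span the sum of the first two.
   Eigenvalues are thus computed coordinatewise in this algebra, and so are
   square roots and geometric means.  For L_GM the three eigenvalues are 0,
   sqrt (x y) and 1 with x, y < 1.  For L_SN and L_BN the condition becomes
   x + m y < a + m b, where m = k - 1 and
   (a, b, x, y) = (p_in^+, p_out^+, p_in^-, p_out^-).
   Given a, b, x in [0, 1] with b < a, the y with x < y < b + (a - x) / m exist
   only if x < a and have measure at most (b - x)^+ + (a - x)^+ / m, whose
   integral over b < a is at most 1/24 + 1/(6 m); the region b < a, x < y has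
   probability 1/4. *)

Set Implicit Arguments.
Unset Strict Implicit.
Unset Printing Implicit Defensive.

Import Order.TTheory GRing.Theory Num.Theory.
Import numFieldNormedType.Exports.

Local Open Scope classical_set_scope.
Local Open Scope ring_scope.

(** * Uniqueness of positive definite square roots *)

Section PositiveDefinite.
Context {R : realType} {n : nat}.
Implicit Types A B X Y : 'M[R]_n.

Lemma mulmx_tr_ge0 (x : 'cV[R]_n) : 0 <= (x^T *m x) 0 0.
Proof.
by rewrite mxE sumr_ge0// => i _; rewrite mxE -expr2 sqr_ge0.
Qed.

Lemma mulmx_tr_eq0 (x : 'cV[R]_n) : ((x^T *m x) 0 0 == 0) = (x == 0).
Proof.
apply/idP/idP => [|/eqP ->]; last by rewrite mulmx0 mxE.
rewrite mxE psumr_eq0 => [/allP h|i _]; last by rewrite mxE -expr2 sqr_ge0.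
apply/eqP/matrixP => i j; rewrite (ord1 j) !mxE; apply/eqP.
by have := h i (mem_index_enum _); rewrite mxE -expr2 sqrf_eq0.
Qed.

(** The quadratic form of [A *m A] at [x] is the squared norm of [A *m x], nonzero by
    invertibility. *)
Lemma posdefmx_sqr A : A^T = A -> A \in unitmx -> posdefmx (A *m A).
Proof.
move=> At Au; split=> [|x x0]; first by rewrite trmx_mul At.
have -> : x^T *m (A *m A) *m x = (A *m x)^T *m (A *m x).
  by rewrite trmx_mul At !mulmxA.
rewrite lt_neqAle eq_sym mulmx_tr_eq0 mulmx_tr_ge0 andbT.
apply: contra x0 => /eqP Ax0; apply/eqP.
by rewrite -(mulKmx Au x) Ax0 mulmx0.
Qed.

Lemma posdefmx_quad_ge0 A (x : 'cV[R]_n) :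
  posdefmx A -> 0 <= (x^T *m A *m x) 0 0.
Proof.
move=> [_ Apos]; have [->|/Apos/ltW//] := eqVneq x 0.
by rewrite mulmx0 mxE.
Qed.

Lemma congr_diag A X i :
  (X^T *m A *m X) i i = ((col i X)^T *m A *m col i X) 0 0.
Proof.
rewrite [col i X]colE trmx_mul trmx_delta -!mulmxA -rowE !mulmxA -colE.
by rewrite [in RHS]mxE [in RHS]mxE.
Qed.

(** The diagonal entries are the values of the form [A] at the columns of [X]; for the same reason a
    zero trace forces every column to vanish. *)
Lemma posdefmx_congr_trace_ge0 A X : posdefmx A -> 0 <= \tr (X^T *m A *m X).
Proof.
move=> Apos; apply: sumr_ge0 => i _; rewrite congr_diag.
exact: posdefmx_quad_ge0.
Qed.

Lemma posdefmx_congr_trace_eq0 A X :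
  posdefmx A -> \tr (X^T *m A *m X) = 0 -> X = 0.
Proof.
move=> Apos /eqP; rewrite /mxtrace psumr_eq0 => [/allP h|i _]; last first.
  by rewrite congr_diag; exact: posdefmx_quad_ge0.
suff cX i : col i X = 0.
  by apply/matrixP => i j; have /colP/(_ i) := cX j; rewrite !mxE.
apply/eqP/negPn/negP => /Apos.2.
rewrite lt_neqAle eq_sym => /andP[/negP XAX0 _].
by apply: XAX0; rewrite -congr_diag; exact: h (mem_index_enum _).
Qed.

(* If A^2 = B^2 then X = A - B solves the Sylvester equation A X = - X B;
   multiplying by X on the left and taking traces, both sides vanish. *)
Lemma posdefmx_sqr_inj A B :
  posdefmx A -> posdefmx B -> A *m A = B *m B -> A = B.
Proof.
move=> Apos Bpos AB; apply/eqP; rewrite -subr_eq0; apply/eqP.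
set X := A - B.
have Xt : X^T = X by rewrite /X raddfB/= Apos.1 Bpos.1.
have trAX := posdefmx_congr_trace_ge0 X Apos.
have trBX := posdefmx_congr_trace_ge0 X Bpos.
have sylv : A *m X + X *m B = 0.
  by rewrite /X mulmxBr mulmxBl AB addrC subrKA subrr.
apply: (posdefmx_congr_trace_eq0 Apos); apply: le_anti; rewrite trAX andbT.
have -> : \tr (X^T *m A *m X) = - \tr (X^T *m B *m X); last by rewrite oppr_le0.
apply/eqP; rewrite -addr_eq0 Xt (mxtrace_mulC (X *m B)) -mxtraceD.
by rewrite -!mulmxA -mulmxDr sylv mulmx0 mxtrace0.
Qed.

(** Injectivity of squaring makes the choice in [sqrtmx] harmless: any explicit positive definite
    root is the chosen one. *)
Lemma sqrtmx_eq A B : posdefmx B -> B *m B = A -> sqrtmx A = B.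
Proof.
move=> Bpos BA; rewrite /sqrtmx; apply: xget_unique; first by split.
move=> C [Cpos CA]; apply: posdefmx_sqr_inj => //; by rewrite CA BA.
Qed.

End PositiveDefinite.

(** * The algebra of matrices spanned by the identity, [H] and [J] *)

Section ClusterMatrices.
Context {R : realType} {k n c : nat} (cl : 'I_n -> 'I_k).
Hypothesis k_ge2 : (2 <= k)%N.
Hypothesis c_ge2 : (2 <= c)%N.
Hypothesis cl_size : forall i : 'I_k, #|cluster_set cl i| = c.

Lemma card_clusters : n = (k * c)%N.
Proof.
rewrite -[LHS]card_ord -sum1_card (partition_big cl predT)//=.
rewrite (eq_bigr (fun=> c)) => [|i _]; first by rewrite sum_nat_const card_ord.
by rewrite -(cl_size i) -sum1_card; apply: eq_bigl => v; rewrite inE.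
Qed.

Lemma sum_cluster (i : 'I_k) : \sum_v (cl v == i)%:R = c%:R :> R.
Proof.
rewrite -natr_sum -(cl_size i) -sum1_card; congr (_%:R).
rewrite [LHS]big_mkcond/= [RHS]big_mkcond/=.
by apply: eq_bigr => v _; rewrite inE; case: eqP.
Qed.

Let c_neq0 : c%:R != 0 :> R.
Proof. by rewrite pnatr_eq0 -lt0n (leq_trans _ c_ge2). Qed.

Let k_neq0 : k%:R != 0 :> R.
Proof. by rewrite pnatr_eq0 -lt0n (leq_trans _ k_ge2). Qed.

Let nE : n%:R = k%:R * c%:R :> R.
Proof. by rewrite {1}card_clusters natrM. Qed.

Definition same_cluster_mx : 'M[R]_n := \matrix_(u, v) (cl u == cl v)%:R.

Let H := same_cluster_mx.
Let J : 'M[R]_n := const_mx 1.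

(** An entry of the product counts the vertices sharing a cluster with both indices. This and the
    next three products close the span of the identity, [H] and [J] under multiplication. *)
Lemma same_cluster_mxM : H *m H = c%:R *: H.
Proof.
apply/matrixP => u v; rewrite !mxE.
under eq_bigr do rewrite !mxE.
have [uv|uv] := eqVneq (cl u) (cl v); last first.
  rewrite mulr0 big1// => w _; have [<-|] := eqVneq (cl u) (cl w).
    by rewrite (negbTE uv) mulr0.
  by rewrite mul0r.
rewrite mulr1 -(sum_cluster (cl v)); apply: eq_bigr => w _.
by rewrite uv eq_sym; case: eqP; rewrite ?mulr1 ?mul0r.
Qed.

Lemma same_cluster_mxMJ : H *m J = c%:R *: J.
Proof.
apply/matrixP => u v; rewrite !mxE mulr1 -(sum_cluster (cl u)).
by apply: eq_bigr => w _; rewrite !mxE mulr1 eq_sym.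
Qed.

Lemma Jsame_cluster_mx : J *m H = c%:R *: J.
Proof.
apply/matrixP => u v; rewrite !mxE mulr1 -(sum_cluster (cl v)).
by apply: eq_bigr => w _; rewrite !mxE mul1r.
Qed.

Lemma const_mx1M : J *m J = (k%:R * c%:R) *: J.
Proof.
apply/matrixP => u v; rewrite !mxE mulr1.
under eq_bigr do rewrite !mxE mulr1.
by rewrite sumr_const card_ord -nE.
Qed.

(* Eigenvalue a on constants, b on the zero-sum vectors constant on clusters,
   g on the vectors summing to 0 on every cluster. *)
Definition cluster_mx (a b g : R) : 'M[R]_n :=
  g%:M + ((b - g) / c%:R) *: H + ((a - b) / (k%:R * c%:R)) *: J.

Lemma cluster_mxD a b g a' b' g' :
  cluster_mx a b g + cluster_mx a' b' g' =
  cluster_mx (a + a') (b + b') (g + g').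
Proof.
apply/matrixP => u v; rewrite !mxE.
by case: (u == v); case: (cl u == cl v) => /=; field; rewrite c_neq0 k_neq0.
Qed.

Lemma cluster_mxZ x a b g :
  x *: cluster_mx a b g = cluster_mx (x * a) (x * b) (x * g).
Proof.
apply/matrixP => u v; rewrite !mxE.
by case: (u == v); case: (cl u == cl v) => /=; field; rewrite c_neq0 k_neq0.
Qed.

Lemma cluster_mx_scalar a : cluster_mx a a a = a%:M.
Proof. by rewrite /cluster_mx subrr !mul0r !scale0r !addr0. Qed.

(** The coefficients [a], [b], [g] multiply the orthogonal idempotents J/(kc), H/c - J/(kc) and I -
    H/c. *)
Lemma cluster_mxM a b g a' b' g' :
  cluster_mx a b g *m cluster_mx a' b' g' =
  cluster_mx (a * a') (b * b') (g * g').
Proof.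
rewrite /cluster_mx !(mulmxDl, mulmxDr) -!(scalemxAl, scalemxAr).
rewrite !mul_scalar_mx !mul_mx_scalar.
rewrite same_cluster_mxM same_cluster_mxMJ Jsame_cluster_mx const_mx1M.
apply/matrixP => u v; rewrite !mxE.
by case: (u == v); case: (cl u == cl v) => /=; field; rewrite c_neq0 k_neq0.
Qed.

Lemma tr_cluster_mx a b g : (cluster_mx a b g)^T = cluster_mx a b g.
Proof. by apply/matrixP => u v; rewrite !mxE (eq_sym v) (eq_sym (cl v)). Qed.

Lemma cluster_mx_inv a b g : a != 0 -> b != 0 -> g != 0 ->
  cluster_mx a b g *m cluster_mx a^-1 b^-1 g^-1 = 1%:M.
Proof. by move=> a0 b0 g0; rewrite cluster_mxM !mulfV// cluster_mx_scalar. Qed.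

Lemma cluster_mx_unit a b g : a != 0 -> b != 0 -> g != 0 ->
  cluster_mx a b g \in unitmx.
Proof.
by move=> a0 b0 g0; have [] := mulmx1_unit (cluster_mx_inv a0 b0 g0).
Qed.

Lemma invmx_cluster_mx a b g : a != 0 -> b != 0 -> g != 0 ->
  invmx (cluster_mx a b g) = cluster_mx a^-1 b^-1 g^-1.
Proof.
move=> a0 b0 g0.
by rewrite -[LHS]mulmx1 -(cluster_mx_inv a0 b0 g0) mulKmx// cluster_mx_unit.
Qed.

Lemma sqrtmx_cluster_mx a b g : 0 < a -> 0 < b -> 0 < g ->
  sqrtmx (cluster_mx a b g) =
  cluster_mx (Num.sqrt a) (Num.sqrt b) (Num.sqrt g).
Proof.
move=> a0 b0 g0.
apply: sqrtmx_eq; last by rewrite cluster_mxM -!expr2 !sqr_sqrtr// ltW.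
(* Fourth roots show the candidate root to be the square of an invertible symmetric matrix, hence
   positive definite. *)
pose s x : R := Num.sqrt (Num.sqrt x).
have sE x : Num.sqrt x = s x * s x by rewrite -expr2 sqr_sqrtr.
rewrite !sE -cluster_mxM; apply: posdefmx_sqr; first exact: tr_cluster_mx.
by apply: cluster_mx_unit; rewrite lt0r_neq0// !sqrtr_gt0.
Qed.

(** The third eigenvalue is 0, since the rows are constant on each cluster. *)
Lemma expected_adjE p q :
  expected_adj cl p q =
  cluster_mx (c%:R * (p + (k%:R - 1) * q)) (c%:R * (p - q)) 0.
Proof.
apply/matrixP => u v; rewrite /cluster_mx !mxE.
by
by case: (u == v); case: (cl u == cl v) => /=; field; rewrite c_neq0 k_neq0.
Qed.

Lemma degree_mx_expected_adj p q :
  degree_mx (expected_adj cl p q) = (c%:R * (p + (k%:R - 1) * q))%:M :> 'M[R]_n.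
Proof.
apply/matrixP => u v; rewrite !mxE; congr (_ *+ _).
transitivity (\sum_w ((p - q) * (cl w == cl u)%:R + q)).
  apply: eq_bigr => w _; rewrite mxE eq_sym.
  by case: eqP => _; rewrite ?mulr1 ?mulr0 ?add0r ?subrK.
rewrite big_split/= -mulr_sumr sum_cluster sumr_const card_ord.
by rewrite -[q *+ n]mulr_natr nE; ring.
Qed.

Lemma mul_cluster_mxE a b g (x : 'cV[R]_n) u :
  (cluster_mx a b g *m x) u 0 =
  g * x u 0 + (b - g) / c%:R * (\sum_v (cl v == cl u)%:R * x v 0) +
  (a - b) / (k%:R * c%:R) * \sum_v x v 0.
Proof.
rewrite /cluster_mx !mulmxDl -!scalemxAl mul_scalar_mx !mxE.
congr (_ + _ * _ + _ * _); apply: eq_bigr => v _; rewrite !mxE ?mul1r//.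
by rewrite eq_sym.
Qed.

(** * The vectors [chi] as eigenvectors *)

Lemma chiE i v : chi cl i v 0 =
  if val i == 0%N then 1 else k%:R * (cl v == i)%:R - 1 :> R.
Proof.
rewrite /chi; case: ifP => _; rewrite !mxE// !inE.
by case: eqP => _ /=; ring.
Qed.

Lemma sum_chi i : \sum_v chi cl i v 0 =
  if val i == 0%N then k%:R * c%:R else 0 :> R.
Proof.
under eq_bigr do rewrite chiE.
case: ifP => _; first by rewrite sumr_const card_ord -nE.
rewrite big_split/= -mulr_sumr sum_cluster sumr_const card_ord.
by rewrite -[(-1) *+ n]mulr_natr nE; ring.
Qed.

Lemma sum_cluster_chi i u : \sum_v (cl v == cl u)%:R * chi cl i v 0 =
  c%:R * chi cl i u 0 :> R.
Proof.
rewrite -(sum_cluster (cl u)) mulr_suml; apply: eq_bigr => v _.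
by rewrite !chiE; have [->|] := eqVneq (cl v) (cl u); rewrite ?mul0r.
Qed.

Lemma cluster_mx_chi a b g i :
  cluster_mx a b g *m chi cl i = (if val i == 0%N then a else b) *: chi cl i.
Proof.
apply/colP => u; rewrite mul_cluster_mxE sum_cluster_chi sum_chi [RHS]mxE chiE.
by case: ifP => _; field; rewrite c_neq0 k_neq0.
Qed.

Lemma cluster_inhabited i : exists v, cl v = i.
Proof.
have : (0 < #|cluster_set cl i|)%N by rewrite cl_size (leq_trans _ c_ge2).
by move=> /card_gt0P[v]; rewrite inE => /eqP <-; exists v.
Qed.

Lemma chi_neq0 i : chi cl i != 0 :> 'cV[R]_n.
Proof.
have [v vi] := cluster_inhabited i.
apply/eqP => /colP/(_ v); rewrite chiE vi eqxx mxE mulr1.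
case: ifP => _ /eqP; first by rewrite oner_eq0.
by rewrite subr_eq0 pnatr_eq1; case: eqP k_ge2 => // ->.
Qed.

Let i0 : 'I_k := Ordinal (ltnW k_ge2).

(** A vanishing combination, evaluated on cluster 0, makes the coefficient of the constant vector
    equal to the sum of the others. Evaluated on cluster [i], it then leaves k times the coefficient
    of [chi cl i]. *)
Lemma chi_row_free : row_free (\matrix_(i < k) (chi cl i)^T : 'M[R]_(k, n)).
Proof.
apply/row_freeP; apply/row_freeP; rewrite -kermx_eq0; apply/rowV0P => y.
move=> /sub_kermxP yM.
have yM0 v : \sum_i y 0 i * chi cl i v 0 = 0 :> R.
  have /rowP/(_ v) := yM; rewrite [RHS]mxE mxE => yMv; rewrite -[RHS]yMv.
  by apply: eq_bigr => i _; rewrite !mxE.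
have yE v : y 0 i0 + \sum_(i | i != i0) y 0 i * (k%:R * (cl v == i)%:R - 1) = 0.
  rewrite -[RHS](yM0 v) [RHS](bigD1 i0)//= chiE/= mulr1; congr (_ + _).
  apply: eq_bigr => i ii0; rewrite chiE; case: ifPn => // /eqP i_0.
  by case/eqP: ii0; apply/val_inj.
have sumE v : \sum_(i | i != i0) y 0 i * (k%:R * (cl v == i)%:R - 1) =
    k%:R * (if cl v != i0 then y 0 (cl v) else 0) - \sum_(i | i != i0) y 0 i.
  transitivity (\sum_(i | i != i0) (k%:R * (y 0 i * (cl v == i)%:R) - y 0 i)).
    by apply: eq_bigr => i _; ring.
  rewrite big_split/= sumrN -mulr_sumr; congr (_ * _ - _).
  case: ifPn => [vi|]; last first.
    rewrite negbK => /eqP ->; rewrite big1// => i ii0.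
    by rewrite eq_sym (negbTE ii0) mulr0.
  rewrite (bigD1 (cl v))//= eqxx mulr1 big1 ?addr0// => i /andP[_ iv].
  by rewrite eq_sym (negbTE iv) mulr0.
have [v0 v0E] := cluster_inhabited i0.
have := yE v0; rewrite sumE v0E eqxx/= mulr0 sub0r => /eqP.
rewrite subr_eq0 => /eqP y0.
have yi i : i != i0 -> y 0 i = 0.
  move=> ii0; have [v vE] := cluster_inhabited i.
  have := yE v; rewrite sumE vE ii0 y0 addrC subrK => /eqP.
  by rewrite mulf_eq0 (negbTE k_neq0)/= => /eqP.
apply/rowP => i; rewrite mxE; have [->|/yi//] := eqVneq i i0.
by rewrite y0 big1.
Qed.

(** For nonzero [i], [chi cl i] is k times the indicator of cluster [i] minus the constant vector,
    to which [x] is orthogonal as well. *)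
Lemma chi_orthogonal_cluster_sum (x : 'cV[R]_n) :
  (forall j, (chi cl j)^T *m x = 0) ->
  forall i, \sum_v (cl v == i)%:R * x v 0 = 0.
Proof.
move=> xorth.
have xE i : \sum_v chi cl i v 0 * x v 0 = 0.
  have /matrixP/(_ 0 0) := xorth i.
  rewrite [RHS]mxE mxE => xi; rewrite -[RHS]xi.
  by apply: eq_bigr => v _; rewrite mxE.
have x0 : \sum_v x v 0 = 0.
  by rewrite -[RHS](xE i0); apply: eq_bigr => v _; rewrite chiE mul1r.
have xi i : i != i0 -> \sum_v (cl v == i)%:R * x v 0 = 0.
  move=> ii0; apply/eqP; rewrite -(mulrI_eq0 _ (mulfI k_neq0)); apply/eqP.
  rewrite -[RHS](xE i) -[LHS]subr0 -[X in _ - X]x0 mulr_sumr -sumrB.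
  apply: eq_bigr => v _; rewrite chiE; case: ifPn => [/eqP i_0|_]; last by ring.
  by case/eqP: ii0; apply/val_inj.
move=> i; have [->|/xi//] := eqVneq i i0.
(* Cluster 0 has no indicator-type vector among the [chi]; its sum is the total minus the other
   cluster sums, all 0. *)
transitivity (\sum_i \sum_v (cl v == i)%:R * x v 0).
  by rewrite (bigD1 i0)//= [X in _ = _ + X]big1 ?addr0.
rewrite exchange_big/= -[RHS]x0; apply: eq_bigr => v _.
rewrite (bigD1 (cl v))//= eqxx mul1r big1 ?addr0// => j.
by rewrite eq_sym => /negbTE ->; rewrite mul0r.
Qed.

Lemma cluster_mx_orthogonal a b g (x : 'cV[R]_n) :
  (forall j, (chi cl j)^T *m x = 0) -> cluster_mx a b g *m x = g *: x.
Proof.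
move=> /chi_orthogonal_cluster_sum x0; apply/colP => u.
rewrite mul_cluster_mxE x0 mulr0 addr0 [RHS]mxE.
have -> : \sum_v x v 0 = \sum_i \sum_v (cl v == i)%:R * x v 0.
  rewrite exchange_big/=; apply: eq_bigr => v _.
  rewrite (bigD1 (cl v))//= eqxx mul1r big1 ?addr0// => j.
  by rewrite eq_sym => /negbTE ->; rewrite mul0r.
by rewrite big1 ?mulr0 ?addr0.
Qed.

(** The difference of two unit vectors in one cluster works, as clusters have at least two vertices.
    It realizes the eigenvalue [g], so that comparison with [g] is a necessary condition. *)
Lemma exists_chi_orthogonal :
  exists2 x : 'cV[R]_n, x != 0 & forall j, (chi cl j)^T *m x = 0.
Proof.
have : (1 < #|cluster_set cl i0|)%N by rewrite cl_size.
move=> /card_gt1P[u [v [+ + uv]]]; rewrite !inE => /eqP cu /eqP cv.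
exists (delta_mx u 0 - delta_mx v 0).
  apply/eqP => /colP/(_ u) /eqP; rewrite !mxE !eqxx (negbTE uv) subr0.
  by rewrite oner_eq0.
move=> j; apply/matrixP => r s; rewrite (ord1 r) (ord1 s) mulmxBr -!colE !mxE.
by rewrite !chiE cu cv subrr.
Qed.

(** On the orthogonal complement of the [chi] the matrix is the scalar [g], so [g] is the only
    remaining eigenvalue. *)
Lemma smallest_eigenvectors_cluster_mx a b g :
  smallest_eigenvectors (cluster_mx a b g) (chi cl) <-> a < g /\ b < g.
Proof.
split=> [[_ small]|[ag bg]].
  have [x x0 xorth] := exists_chi_orthogonal.
  have lt_g (i : 'I_k) : (if val i == 0%N then a else b) < g.
    have [e [[_ chie] eg]] := small i.
    have -> : (if val i == 0%N then a else b) = e.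
      move: chie; rewrite cluster_mx_chi => /eqP.
      rewrite -subr_eq0 -scalerBl scaler_eq0 (negbTE (chi_neq0 i)) orbF.
      by rewrite subr_eq0 => /eqP.
    by apply: (eg _ x) => //; split; rewrite ?cluster_mx_orthogonal.
  (* The labels 0 and 1 carry the eigenvalues [a] and [b]. *)
  by split; [exact: (lt_g i0) | exact: (lt_g (Ordinal k_ge2))].
split=> [|i]; first exact: chi_row_free.
exists (if val i == 0%N then a else b); split.
  by split; [exact: chi_neq0 | exact: cluster_mx_chi].
move=> e x [x0 xe] xorth.
suff -> : e = g by case: ifP.
move: xe; rewrite cluster_mx_orthogonal// => /eqP.
by rewrite -subr_eq0 -scalerBl scaler_eq0 (negbTE x0) orbF subr_eq0 => /eqP.
Qed.

(** * Geometric means within the algebra *)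

Lemma cluster_mxB a b g a' b' g' :
  cluster_mx a b g - cluster_mx a' b' g' =
  cluster_mx (a - a') (b - b') (g - g').
Proof. by rewrite -scaleN1r cluster_mxZ cluster_mxD !mulN1r. Qed.

Lemma gmean_posdef_cluster_mx a b g a' b' g' :
  0 < a -> 0 < b -> 0 < g -> 0 < a' -> 0 < b' -> 0 < g' ->
  gmean_posdef (cluster_mx a b g) (cluster_mx a' b' g') =
  cluster_mx (Num.sqrt (a * a')) (Num.sqrt (b * b')) (Num.sqrt (g * g')).
Proof.
have sqrtE x y : 0 < x -> 0 < y ->
    Num.sqrt x * Num.sqrt ((Num.sqrt x)^-1 * y * (Num.sqrt x)^-1) * Num.sqrt x =
    Num.sqrt (x * y) :> R.
  move=> x0 y0; have -> : (Num.sqrt x)^-1 * y * (Num.sqrt x)^-1 = y / x.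
    by rewrite [_ * y]mulrC -mulrA -invfM -expr2 sqr_sqrtr ?ltW.
  rewrite -sqrtrM ?ltW// -sqrtrM; last by rewrite mulr_ge0 ?divr_ge0// ltW.
  by congr Num.sqrt; field; rewrite lt0r_neq0.
move=> a0 b0 g0 a'0 b'0 g'0; rewrite /gmean_posdef /invsqrtmx.
rewrite sqrtmx_cluster_mx// invmx_cluster_mx ?lt0r_neq0 ?sqrtr_gt0//.
rewrite !cluster_mxM sqrtmx_cluster_mx ?mulr_gt0 ?invr_gt0 ?sqrtr_gt0//.
by rewrite !cluster_mxM !sqrtE.
Qed.

(** Adding [e%:M] shifts all three eigenvalues by [e], so the positive definite formula holds for
    every [e > 0], and continuity of the square root gives the limit. Zero eigenvalues must be
    allowed because [Lsym_plus] kills constants. *)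
Lemma gmean_cluster_mx a b g a' b' g' :
  0 <= a -> 0 <= b -> 0 <= g -> 0 <= a' -> 0 <= b' -> 0 <= g' ->
  gmean (cluster_mx a b g) (cluster_mx a' b' g') =
  cluster_mx (Num.sqrt (a * a')) (Num.sqrt (b * b')) (Num.sqrt (g * g')).
Proof.
move=> a0 b0 g0 a'0 b'0 g'0; apply: cvg_lim; first exact: norm_hausdorff.
have sqrt_cvg (x y : R) :
    Num.sqrt ((x + e) * (y + e)) @[e --> 0^'+] --> Num.sqrt (x * y).
  apply: continuous_cvg; first exact: sqrt_continuous.
  apply: cvg_at_right_filter; rewrite -[x in x * _]addr0 -[y in _ * y]addr0.
  by apply: cvgM; apply: cvgD; by [exact: cvg_cst | exact: cvg_id].
have lim_cvg : cluster_mx (Num.sqrt ((a + e) * (a' + e)))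
    (Num.sqrt ((b + e) * (b' + e)))
    (Num.sqrt ((g + e) * (g' + e))) @[e --> 0^'+] -->
    cluster_mx (Num.sqrt (a * a')) (Num.sqrt (b * b')) (Num.sqrt (g * g')).
  rewrite /cluster_mx -scalemx1; under eq_fun do rewrite -scalemx1.
  do 2?[apply: cvgD]; apply: cvgZr_tmp; rewrite //; apply: cvgMr_tmp;
    exact: cvgB.
apply: cvg_trans lim_cvg; apply: near_eq_cvg; near=> e.
have e0 : 0 < e by near: e; exact: nbhs_right_gt.
rewrite -!cluster_mx_scalar !cluster_mxD gmean_posdef_cluster_mx//;
  by rewrite ltr_wpDl.
Unshelve. all: by end_near. Qed.

Lemma invsqrtmx_scalar_conj d a b g : 0 < d ->
  invsqrtmx (cluster_mx d d d) *m cluster_mx a b g *m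
    invsqrtmx (cluster_mx d d d) =
  cluster_mx (a / d) (b / d) (g / d).
Proof.
move=> d0; rewrite /invsqrtmx sqrtmx_cluster_mx//.
rewrite invmx_cluster_mx ?lt0r_neq0 ?sqrtr_gt0// !cluster_mxM.
by congr cluster_mx; rewrite mulrAC mulrC -invfM -expr2 sqr_sqrtr// ltW.
Qed.

(** * Spectra of the signed Laplacians *)

Let k1_ge1 : 1 <= k%:R - 1 :> R.
Proof. by have : 2 <= k%:R :> R; [rewrite ler_nat | lra]. Qed.

Let c_gt0 : 0 < c%:R :> R.
Proof. by rewrite ltr0n (leq_trans _ c_ge2). Qed.

Let degree (p q : R) := c%:R * (p + (k%:R - 1) * q).

Let degree_gt0 (p q : R) : 0 <= p -> 0 <= q -> 0 < p + q -> 0 < degree p q.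
Proof.
move=> p0 q0 pq0; rewrite mulr_gt0//; apply: (lt_le_trans pq0).
by rewrite lerD2l ler_peMl.
Qed.

(** The eigenvalues of [Lsym_plus] are 0, x, 1 and those of [Qsym_minus] are 2, y, 1, where each of
    the two inequalities puts one of x, y in [0, 1). *)
Lemma L_GM_smallest (pinP poutP pinM poutM : R) :
  0 <= pinP -> 0 <= poutP -> 0 <= pinM -> 0 <= poutM ->
  poutP < pinP -> pinM < poutM ->
  smallest_eigenvectors (L_GM cl pinP poutP pinM poutM)
    (chi cl : _ -> 'cV[R]_n).
Proof.
move=> pinP0 poutP0 pinM0 poutM0 ltP ltM.
have dP0 : 0 < degree pinP poutP by apply: degree_gt0 => //; lra.
have dM0 : 0 < degree pinM poutM by apply: degree_gt0 => //; lra.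
have ltP' : 0 < c%:R * (pinP - poutP) by rewrite mulr_gt0// subr_gt0.
have ltM' : c%:R * (pinM - poutM) < 0 by rewrite pmulr_rlt0// subr_lt0.
have leP : c%:R * (pinP - poutP) <= degree pinP poutP.
  rewrite ler_pM2l// lerD2l; apply: (@le_trans _ _ 0).
    by rewrite oppr_le0.
  by rewrite mulr_ge0// (le_trans _ k1_ge1).
(* Up to the factor c this is 2 [pinM] + (k - 2) [poutM]; it makes [Qsym_minus] positive
   semidefinite. *)
have leM : 0 <= degree pinM poutM + c%:R * (pinM - poutM).
  rewrite -mulrDr mulr_ge0 ?(ltW c_gt0)//.
  have : poutM <= (k%:R - 1) * poutM by rewrite ler_peMl.
  lra.
rewrite /L_GM /Lsym_plus /Qsym_minus !degree_mx_expected_adj -/(degree _ _).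
rewrite -/(degree _ _) !expected_adjE -!/(degree _ _).
rewrite -!cluster_mx_scalar cluster_mxB cluster_mxD.
rewrite !invsqrtmx_scalar_conj// !subrr subr0 addr0 mul0r.
rewrite !divff ?lt0r_neq0//.
rewrite gmean_cluster_mx ?divr_ge0 ?subr_ge0 ?(ltW dP0) ?(ltW dM0) ?leM//;
  last by rewrite addr_ge0// ltW.
apply/smallest_eigenvectors_cluster_mx; rewrite mul0r mulr1 sqrtr0 sqrtr1.
split=> //; rewrite -[ltRHS]sqrtr1 ltr_sqrt//.
set x := _ / _; set y := _ / _.
have x1 : x < 1 by rewrite ltr_pdivrMr// mul1r gtrBl.
have y1 : y < 1 by rewrite ltr_pdivrMr// mul1r gtrDl.
have x0 : 0 <= x by rewrite divr_ge0 ?subr_ge0// ltW.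
have y0 : 0 <= y by rewrite divr_ge0// ltW.
nra.
Qed.

Section LinearIdentification.
Variables pinP poutP pinM poutM : R.
Hypotheses (pinP0 : 0 <= pinP) (poutP0 : 0 <= poutP).
Hypotheses (pinM0 : 0 <= pinM) (poutM0 : 0 <= poutM).
Hypotheses (ltP : poutP < pinP) (ltM : pinM < poutM).

Let dP0 : 0 < degree pinP poutP.
Proof. by rewrite degree_gt0// ltr_wpDr// (le_lt_trans poutP0). Qed.

Let dM0 : 0 < degree pinM poutM.
Proof. by rewrite degree_gt0// ltr_wpDl// (le_lt_trans pinM0). Qed.

Let ltP' : 0 < c%:R * (pinP - poutP).
Proof. by rewrite mulr_gt0// subr_gt0. Qed.

Let ltM' : c%:R * (pinM - poutM) < 0.
Proof. by rewrite pmulr_rlt0// subr_lt0. Qed.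

(** With d the total degree, the numerators of the eigenvalues are 2 [degree pinM poutM], d + c
    ([pinM] - [poutM]) - c ([pinP] - [poutP]) and d. The second is below d by [ltP] and [ltM]; only
    the first imposes a condition. *)
Lemma L_SN_smallest :
  smallest_eigenvectors (L_SN cl pinP poutP pinM poutM)
    (chi cl : _ -> 'cV[R]_n) <->
  pinM + (k%:R - 1) * poutM < pinP + (k%:R - 1) * poutP.
Proof.
have d0 : 0 < degree pinP poutP + degree pinM poutM by rewrite addr_gt0.
rewrite /L_SN !degree_mx_expected_adj -!/(degree _ _).
rewrite !expected_adjE -!/(degree _ _) -!cluster_mx_scalar !cluster_mxD.
rewrite cluster_mxB cluster_mxD invsqrtmx_scalar_conj//.
rewrite smallest_eigenvectors_cluster_mx !ltr_pM2r ?invr_gt0//.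
rewrite -(ltr_pM2l c_gt0 (pinM + _)) -/(degree _ _) -/(degree _ _).
by move: ltP' ltM' => h1 h2; split=> [[dPM _]|dPM]; [|split]; lra.
Qed.

(** Compared with [L_SN], the numerators all drop by [degree pinM poutM], which leaves their
    comparisons unchanged. *)
Lemma L_BN_smallest :
  smallest_eigenvectors (L_BN cl pinP poutP pinM poutM)
    (chi cl : _ -> 'cV[R]_n) <->
  pinM + (k%:R - 1) * poutM < pinP + (k%:R - 1) * poutP.
Proof.
have d0 : 0 < degree pinP poutP + degree pinM poutM by rewrite addr_gt0.
rewrite /L_BN !degree_mx_expected_adj -!/(degree _ _).
rewrite !expected_adjE -!/(degree _ _) -!cluster_mx_scalar !cluster_mxD.
rewrite cluster_mxB cluster_mxD invmx_cluster_mx ?lt0r_neq0// cluster_mxM.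
rewrite smallest_eigenvectors_cluster_mx !ltr_pM2l ?invr_gt0//.
rewrite -(ltr_pM2l c_gt0 (pinM + _)) -/(degree _ _) -/(degree _ _).
by move: ltP' ltM' => h1 h2; split=> [[dPM _]|dPM]; [|split]; lra.
Qed.

End LinearIdentification.

End ClusterMatrices.

(** * Measures and integrals for the uniform law on the unit interval *)

Section UniformIntegrals.
Context {R : realType}.
Local Notation U01 := (uniform_prob (@ltr01 R)).

Lemma uniform_probE (A : set (measurableTypeR R)) : measurable A ->
  U01 A = @lebesgue_measure R (A `&` `[0%R, 1%R]).
Proof.
move=> mA; rewrite /uniform_prob integral_uniform_pdf.
rewrite (eq_integral (fun=> 1%E)) => [|z]; last first.
  rewrite inE => -[_]; rewrite /= /uniform_pdf in_itv/= => ->.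
  by rewrite subr0 invr1.
by rewrite integral_cst ?mul1e//; exact: measurableI.
Qed.

Lemma uniform_le_itv (A : set (measurableTypeR R)) (x y : R) : measurable A ->
  A `&` `[0%R, 1%R] `<=` `]x, y] -> (U01 A <= (Num.max 0 (y - x))%:E)%E.
Proof.
move=> mA Axy; rewrite uniform_probE//.
apply: (@le_trans _ _ (lebesgue_measure (`]x, y] : set R))).
  by apply: le_measure => //; rewrite inE//; exact: measurableI.
rewrite lebesgue_measure_itv/= lte_fin; case: ltP => xy.
  by rewrite -EFinB lee_fin le_max lexx orbT.
by rewrite lee_fin le_max lexx.
Qed.

Lemma uniform_ge_itv (A : set (measurableTypeR R)) (x y : R) : measurable A ->
  `]x, y] `<=` A `&` `[0%R, 1%R] -> ((y - x)%:E <= U01 A)%E.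
Proof.
move=> mA Axy; rewrite uniform_probE//.
apply: (@le_trans _ _ (lebesgue_measure (`]x, y] : set R))); last first.
  by apply: le_measure => //; rewrite inE//; exact: measurableI.
rewrite lebesgue_measure_itv/= lte_fin; case: ltP => xy.
  by rewrite -EFinB lee_fin.
by rewrite lee_fin subr_le0.
Qed.

(** Fundamental theorem of calculus. The flag [s] opens ([true]) or closes ([false]) the right end,
    to accommodate strict and large inequalities. *)
Lemma uniform_integral_deriv s (t : R) (p : {poly R}) : 0 <= t <= 1 ->
  (forall x, x \in `[0, t] -> 0 <= p^`().[x]) ->
  (\int[U01]_x
     (if x \in Interval (BLeft 0) (BSide s t) then p^`().[x] else 0)%:E
    = (p.[t] - p.[0])%:E)%E.
Proof.
move=> /andP[t0 t1] p0; pose I := Interval (BLeft 0) (BSide s t).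
have mp : measurable_fun setT (horner p^`() : measurableTypeR R -> R).
  by apply: continuous_measurable_fun; exact: continuous_horner.
have I0t : [set` I] `<=` `[0, t].
  by move=> x; rewrite /= !in_itv/= => /andP[-> /lteifW].
rewrite integral_uniform//; last 2 first.
- apply/measurable_EFinP; apply: measurable_fun_ifT => //.
  apply: (measurable_fun_bool true); rewrite setTI.
  exact: measurable_itv.
- by move=> x; case: ifPn => // xI; rewrite lee_fin p0//; apply: I0t.
rewrite subr0 invr1 mul1e.
transitivity (\int[@lebesgue_measure R]_(x in `[0%R, 1%R] `&` [set` I])
  (p^`().[x])%:E)%E.
  rewrite integral_mkcondr; apply: eq_integral => x _.
  by rewrite patchE mem_setE; case: ifP.
rewrite setIidr; last first.
  apply: (subset_trans I0t); apply: subset_itvl; exact: t1.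
transitivity (\int[@lebesgue_measure R]_(x in `[0%R, t]) (p^`().[x])%:E)%E.
  rewrite /I; case: s {I I0t} => //; apply: integral_itv_bndo_bndc.
  by apply/measurable_EFinP; exact: measurable_funTS.
(* The fundamental theorem is applied on a nondegenerate interval, so [t = 0] is treated apart. *)
have [t00|] := eqVneq t 0.
  by rewrite t00 set_itv1 integral_set1 subrr.
rewrite neq_lt ltNge t0/= => t_gt0.
rewrite (@continuous_FTC2 _ _ (horner p))// ?EFinB//.
- by apply: continuous_subspaceT; exact: continuous_horner.
- split=> [x _||]; first exact: derivable_horner.
  + by apply: cvg_at_right_filter; exact: continuous_horner.
  + by apply: cvg_at_left_filter; exact: continuous_horner.
- by move=> x _; rewrite -derivE.
Qed.
End UniformIntegrals.

(** * Iterated integration with explicit inner integrals *)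

Section Tonelli.
Context d1 d2 (T1 : measurableType d1) (T2 : measurableType d2) (R : realType).
Variables (m1 : {sigma_finite_measure set T1 -> \bar R})
          (m2 : {sigma_finite_measure set T2 -> \bar R}).
Variables (f : T1 * T2 -> R) (g : T1 -> R).
Hypothesis mf : measurable_fun setT f.
Hypothesis f0 : forall z, 0 <= f z.
Hypothesis fg : forall x, (\int[m2]_y (f (x, y))%:E = (g x)%:E)%E.

Let mEf : measurable_fun setT (EFin \o f).
Proof. exact/measurable_EFinP. Qed.

Let gE : fubini_F m2 (EFin \o f) = EFin \o g.
Proof. by apply/funext => x; rewrite /fubini_F /= fg. Qed.

Lemma tonelli_ge0 x : 0 <= g x.
Proof. by rewrite -lee_fin -fg integral_ge0// => y _; rewrite lee_fin. Qed.

(** The hypothesis [fg] identifies [g] with the inner integral, whose measurability is part of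
    Tonelli's theorem; so only the integrand of the full cube needs a measurability proof. *)
Lemma tonelli_measurable : measurable_fun setT g.
Proof.
apply/measurable_EFinP; rewrite -gE.
by apply: measurable_fun_fubini_tonelli_F => // z; rewrite lee_fin.
Qed.

Lemma tonelli_integral : (\int[m1 \x m2]_z (f z)%:E = \int[m1]_x (g x)%:E)%E.
Proof.
by rewrite (fubini_tonelli1 _ mEf) ?gE.
Qed.

End Tonelli.

(** * Integrals over regions of the unit cube *)

Section UniformCube.
Context {R : realType}.
Local Notation U01 := (uniform_prob (@ltr01 R)).

Local Notation T := (measurableTypeR R).

Lemma integral_uniform3 (F : T * T * T -> R) (F2 : T * T -> R) (F1 : T -> R) :
  measurable_fun setT F -> (forall z, 0 <= F z) ->
  (forall p, (\int[U01]_x (F (p, x))%:E = (F2 p)%:E)%E) ->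
  (forall a, (\int[U01]_b (F2 (a, b))%:E = (F1 a)%:E)%E) ->
  (\int[U01 \x U01 \x U01]_z (F z)%:E = \int[U01]_a (F1 a)%:E)%E.
Proof.
move=> mF F0 FF2 F2F1.
pose U2 : probability (T * T)%type R := (U01 \x U01)%E.
etransitivity; first exact: (tonelli_integral U2 mF F0 FF2).
apply: (tonelli_integral U01 _ _ F2F1).
- exact: (tonelli_measurable mF F0 FF2).
- exact: (tonelli_ge0 F0 FF2).
Qed.

Lemma uniform_integral_cubic s (t a b c d : R) (f : R -> R) : 0 <= t <= 1 ->
  (forall x, f x = a + b * x + c * x ^+ 2 + d * x ^+ 3) ->
  (forall x, x \in `[0, t] -> 0 <= f x) ->
  (\int[U01]_x (if x \in Interval (BLeft 0) (BSide s t) then f x else 0)%:E =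
   (a * t + b * t ^+ 2 / 2 + c * t ^+ 3 / 3 + d * t ^+ 4 / 4)%:E)%E.
Proof.
move=> t01 fE f0.
(* The antiderivative of [f] vanishing at 0. *)
pose p : {poly R} :=
  a *: 'X + (b / 2) *: 'X^2 + (c / 3) *: 'X^3 + (d / 4) *: 'X^4.
have pE x : p^`().[x] = f x.
  rewrite fE /p !poly.derivE /= !hornerE /=; lra.
transitivity (p.[t] - p.[0])%:E; last by congr EFin; rewrite !hornerE /=; lra.
rewrite -(uniform_integral_deriv s t01) => [|x /f0]; last by rewrite pE.
by apply: eq_integral => x _; rewrite pE.
Qed.

(** The bound on [b] depends on [a], and that on [x] on both, so the integral is computed from the
    innermost variable [x] outwards. The integrand is 0 outside the region. *)
Lemma integral_uniform3_region s (t2 : R -> R) (t3 : R -> R -> R)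
    (f : R -> R -> R -> R) (f2 : R -> R -> R) (f1 : R -> R) :
  let T3 := (T * T * T)%type in
  let F (z : T3) : R :=
    if [&& z.1.1 \in `[0, 1], z.1.2 \in Interval (BLeft 0) (BSide s (t2 z.1.1))
         & z.2 \in `[0, t3 z.1.1 z.1.2]] then f z.1.1 z.1.2 z.2 else 0 in
  measurable_fun setT (fun z : T3 => t2 z.1.1 : R) ->
  measurable_fun setT (fun z : T3 => t3 z.1.1 z.1.2 : R) ->
  measurable_fun setT (fun z : T3 => f z.1.1 z.1.2 z.2 : R) ->
  (forall a b x : R, a \in `[0, 1] -> b \in `[0, t2 a] -> x \in `[0, t3 a b] ->
     0 <= f a b x) ->
  (forall a b : R, a \in `[0, 1] -> b \in `[0, t2 a] ->
     (\int[U01]_x (if x \in `[0%R, t3 a b] then f a b x else 0)%:E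
       = (f2 a b)%:E)%E) ->
  (forall a : R, a \in `[0, 1] ->
     (\int[U01]_b
        (if b \in Interval (BLeft 0%R) (BSide s (t2 a)) then f2 a b else 0)%:E
       = (f1 a)%:E)%E) ->
  measurable_fun setT F /\
  (\int[U01 \x U01 \x U01]_z (F z)%:E =
   \int[U01]_a (if a \in `[0%R, 1%R] then f1 a else 0)%:E)%E.
Proof.
move=> T3 F mt2 mt3 mf f0 ff2 f2f1.
have Is (a b : R) :
    b \in Interval (BLeft 0) (BSide s (t2 a)) -> b \in `[0, t2 a].
  by rewrite !in_itv/= => /andP[-> /lteifW].
have m1 : measurable_fun setT (fun z : T3 => z.1.1 : R).
  by apply: (measurableT_comp measurable_fst); exact: measurable_fst.
have m2 : measurable_fun setT (fun z : T3 => z.1.2 : R).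
  by apply: (measurableT_comp measurable_snd); exact: measurable_fst.
have m3 : measurable_fun setT (fun z : T3 => z.2 : R) by exact: measurable_snd.
have mF : measurable_fun setT F.
  apply: measurable_fun_ifT => //; apply: measurable_and.
    by apply: measurable_and; exact: measurable_fun_ler.
  apply: measurable_and.
    apply: measurable_and; first exact: measurable_fun_ler.
    by case: s @F Is f2f1 => *;
      [exact: measurable_fun_ltr|exact: measurable_fun_ler].
  by apply: measurable_and; exact: measurable_fun_ler.
split=> //.
pose F2 (p : T * T) : R :=
  if (p.1 \in `[0, 1]) && (p.2 \in Interval (BLeft 0) (BSide s (t2 p.1)))
  then f2 p.1 p.2 else 0.
apply: (@integral_uniform3 _ F2 _ mF).
- move=> [[a b] x]; rewrite /F /=; case: ifP => // /and3P[a01 bt xt].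
  by apply: f0 => //; exact: Is.
- move=> [a b]; rewrite /F /F2 /=.
  have [a01|a01] := boolP (a \in `[0, 1]) => /=; last exact: integral0.
  have [bt|bt] := boolP (b \in _) => /=; last exact: integral0.
  by apply: ff2 => //; exact: Is.
- move=> a; rewrite /F2 /=.
  have [a01|a01] := boolP (a \in `[0, 1]) => /=; last exact: integral0.
  exact: f2f1.
Qed.

End UniformCube.

(** * The three explicit volumes *)

Section AssortativeVolume.
Context {R : realType}.
Local Notation U01 := (uniform_prob (@ltr01 R)).
Local Notation T := (measurableTypeR R).

(* With z = (a, b, x), lower_gap + slack m bounds from above the measure of the
   y-section of identified_event m, and upper_tail bounds from below that of
   assortative_event. *)
Definition lower_gap (z : T * T * T) : R :=
    if [&& z.1.1 \in `[0, 1], z.1.2 \in `[0, z.1.1] & z.2 \in `[0, z.1.2]]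
    then z.1.2 - z.2 else 0.

(** The successive integrals are b^2/2, a^3/6 and 1/24. *)
Lemma integral_lower_gap :
  measurable_fun setT lower_gap /\
  (\int[U01 \x U01 \x U01]_z (lower_gap z)%:E = (24%:R^-1)%:E)%E.
Proof.
have [||||||mF FE] := @integral_uniform3_region R false id
  (fun _ b => b) (fun _ b x => b - x) (fun _ b => b ^+ 2 / 2)
  (fun a => a ^+ 3 / 6).
- by apply: (measurableT_comp measurable_fst); exact: measurable_fst.
- by apply: (measurableT_comp measurable_snd); exact: measurable_fst.
- apply: measurable_funB; last exact: measurable_snd.
  by apply: (measurableT_comp measurable_snd); exact: measurable_fst.
- by move=> a b x _ _; rewrite in_itv/= subr_ge0 => /andP[].
- move=> a b; rewrite !in_itv/= => /andP[a0 a1] /andP[b0 ba].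
  rewrite (@uniform_integral_cubic _ false b b (-1) 0 0 (fun x => b - x)).
  + congr EFin; lra.
  + by rewrite b0 (le_trans ba).
  + by move=> x; lra.
  + by move=> x; rewrite in_itv/= subr_ge0 => /andP[].
- move=> a; rewrite in_itv/= => a01.
  rewrite (@uniform_integral_cubic _ false a 0 0 2^-1 0
    (fun b => b ^+ 2 / 2))//.
  + congr EFin; lra.
  + by move=> x; lra.
  + by move=> x; rewrite in_itv/= => /andP[x0 _]; rewrite divr_ge0// exprn_ge0.
split; [exact: mF | etransitivity; first exact: FE].
rewrite (@uniform_integral_cubic _ false 1 0 0 0 6^-1 (fun a => a ^+ 3 / 6)).
- congr EFin; lra.
- by rewrite ler01 lexx.
- by move=> x; lra.
- by move=> x; rewrite in_itv/= => /andP[x0 _]; rewrite divr_ge0// exprn_ge0.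
Qed.

Definition slack (m : R) (z : T * T * T) : R :=
    if [&& z.1.1 \in `[0, 1], z.1.2 \in `[0, 1] & z.2 \in `[0, z.1.1]]
    then (z.1.1 - z.2) / m else 0.

(** Here [b] ranges over [0, 1] instead of [0, a]. The larger region gives a^2/(2m) twice and then
    1/(6m), which is the coefficient wanted after division by 1/4. *)
Lemma integral_slack (m : R) : 0 < m ->
  measurable_fun setT (slack m) /\
  (\int[U01 \x U01 \x U01]_z (slack m z)%:E = ((6 * m)^-1)%:E)%E.
Proof.
move=> m0; have mV : 0 <= m^-1 by rewrite invr_ge0 ltW.
have [||||||mF FE] := @integral_uniform3_region R false (fun=> 1)
  (fun a _ => a) (fun a _ x => (a - x) / m) (fun a _ => a ^+ 2 / (2 * m))
  (fun a => a ^+ 2 / (2 * m)).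
- exact: measurable_cst.
- by apply: (measurableT_comp measurable_fst); exact: measurable_fst.
- apply: measurable_funM; last exact: measurable_cst.
  apply: measurable_funB; last exact: measurable_snd.
  by apply: (measurableT_comp measurable_fst); exact: measurable_fst.
- move=> a b x _ _; rewrite in_itv/= => /andP[_ xa].
  by rewrite mulr_ge0// subr_ge0.
- move=> a b; rewrite !in_itv/= => a01 _.
  rewrite (@uniform_integral_cubic _ false a (a / m) (- m^-1) 0 0
    (fun x => (a - x) / m))//.
  + by congr EFin; rewrite invfM; lra.
  + by move=> x; lra.
  + by move=> x; rewrite in_itv/= => /andP[_ xa]; rewrite mulr_ge0// subr_ge0.
- move=> a _; have a2 : 0 <= a ^+ 2 / (2 * m).
    by rewrite divr_ge0 ?sqr_ge0// mulr_ge0// ltW.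
  rewrite (@uniform_integral_cubic _ false 1 (a ^+ 2 / (2 * m)) 0 0 0
    (fun=> a ^+ 2 / (2 * m)))//.
  + congr EFin; lra.
  + by rewrite ler01 lexx.
  + by move=> x; lra.
split; [exact: mF | etransitivity; first exact: FE].
rewrite (@uniform_integral_cubic _ false 1 0 0 (2 * m)^-1 0
  (fun a => a ^+ 2 / (2 * m))).
- by congr EFin; rewrite !invfM; lra.
- by rewrite ler01 lexx.
- by move=> x; lra.
- by move=> x _; rewrite divr_ge0 ?sqr_ge0// mulr_ge0// ltW.
Qed.

Definition upper_tail (z : T * T * T) : R :=
    if [&& z.1.1 \in `[0, 1], z.1.2 \in `[0, z.1.1[ & z.2 \in `[0, 1]]
    then 1 - z.2 else 0.

(** The range of [b] is open at [a], so that the integrand vanishes wherever [b < a] fails. *)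
Lemma integral_upper_tail :
  measurable_fun setT upper_tail /\
  (\int[U01 \x U01 \x U01]_z (upper_tail z)%:E = (4%:R^-1)%:E)%E.
Proof.
have [||||||mF FE] := @integral_uniform3_region R true id
  (fun _ _ => 1) (fun _ _ x => 1 - x) (fun _ _ => 2^-1) (fun a => a / 2).
- by apply: (measurableT_comp measurable_fst); exact: measurable_fst.
- exact: measurable_cst.
- by apply: measurable_funB; [exact: measurable_cst | exact: measurable_snd].
- by move=> a b x _ _; rewrite in_itv/= subr_ge0 => /andP[].
- move=> a b _ _.
  rewrite (@uniform_integral_cubic _ false 1 1 (-1) 0 0 (fun x => 1 - x)).
  + congr EFin; lra.
  + by rewrite ler01 lexx.
  + by move=> x; lra.
  + by move=> x; rewrite in_itv/= subr_ge0 => /andP[].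
- move=> a; rewrite in_itv/= => a01.
  rewrite (@uniform_integral_cubic _ true a 2^-1 0 0 0 (fun=> 2^-1))//.
  + congr EFin; lra.
  + by move=> x; lra.
split; [exact: mF | etransitivity; first exact: FE].
rewrite (@uniform_integral_cubic _ false 1 0 2^-1 0 0 (fun a => a / 2)).
- congr EFin; lra.
- by rewrite ler01 lexx.
- by move=> x; lra.
- by move=> x; rewrite in_itv/= => /andP[x0 _]; rewrite divr_ge0.
Qed.

End AssortativeVolume.

(** * Probabilities of the two events *)

Section AssortativeProbability.
Context {R : realType}.
Local Notation U01 := (uniform_prob (@ltr01 R)).
Local Notation T := (measurableTypeR R).

(** The boolean form reduces measurability to that of the single comparisons. *)
Definition assortative_event : set (params R) :=
  [set p | [&& 0 <= p.1.1.1 <= 1, 0 <= p.1.1.2 <= 1, 0 <= p.1.2 <= 1,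
               0 <= p.2 <= 1, p.1.1.2 < p.1.1.1 & p.1.2 < p.2]].

(** For m = k - 1 this is the common criterion of [L_SN_smallest] and [L_BN_smallest], which hold
    under the assortative inequalities. *)
Definition identified_event (m : R) : set (params R) :=
  assortative_event `&` [set p | p.1.2 + m * p.2 < p.1.1.1 + m * p.1.1.2].

Let m1 : measurable_fun setT (fun p : params R => p.1.1.1 : R).
Proof.
apply: (measurableT_comp measurable_fst).
by apply: (measurableT_comp measurable_fst); exact: measurable_fst.
Qed.

Let m2 : measurable_fun setT (fun p : params R => p.1.1.2 : R).
Proof.
apply: (measurableT_comp measurable_snd).
by apply: (measurableT_comp measurable_fst); exact: measurable_fst.
Qed.

Let m3 : measurable_fun setT (fun p : params R => p.1.2 : R).
Proof. by apply: (measurableT_comp measurable_snd); exact: measurable_fst. Qed.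

Let m4 : measurable_fun setT (fun p : params R => p.2 : R).
Proof. exact: measurable_snd. Qed.

Lemma measurable_assortative_event : measurable assortative_event.
Proof.
rewrite -[assortative_event]setTI.
suff /(_ measurableT [set true] I) : measurable_fun setT (fun p : params R =>
  [&& 0 <= p.1.1.1 <= 1, 0 <= p.1.1.2 <= 1, 0 <= p.1.2 <= 1, 0 <= p.2 <= 1,
      p.1.1.2 < p.1.1.1 & p.1.2 < p.2]) by exact.
by repeat (apply: measurable_and);
  first [exact: measurable_fun_ler | exact: measurable_fun_ltr].
Qed.

Lemma measurable_identified_event m : measurable (identified_event m).
Proof.
apply: measurableI; first exact: measurable_assortative_event.
rewrite -[X in measurable X]setTI.
suff /(_ measurableT [set true] I) : measurable_fun setT (fun p : params R =>
  p.1.2 + m * p.2 < p.1.1.1 + m * p.1.1.2) by exact.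
by apply: measurable_fun_ltr; apply: measurable_funD => //;
  apply: measurable_funM.
Qed.

Let U3 : probability (T * T * T)%type R := (U01 \x U01 \x U01)%E.

Let uniform4E (A : set (params R)) :
  uniform4 R A = (\int[U3]_z U01 (xsection A z))%E.
Proof. by []. Qed.

Let measurable_section (A : set (params R)) : measurable A ->
  measurable_fun setT (fun z => U01 (xsection A z)).
Proof. exact: measurable_fun_xsection. Qed.

(** When [b < a], the section over (a, b, x) contains []x, 1]]. A lower bound is enough for a
    denominator. *)
Lemma uniform4_assortative_ge :
  ((4%:R^-1)%:E <= uniform4 R assortative_event)%E.
Proof.
have [mF <-] := @integral_upper_tail R.
have mA := measurable_assortative_event.
rewrite uniform4E; apply: ge0_le_integral => //.
- move=> [[a b] x] _; rewrite lee_fin /upper_tail /=.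
  by case: ifP => // /and3P[_ _]; rewrite in_itv/= subr_ge0 => /andP[].
- exact/measurable_EFinP.
- exact: measurable_section.
move=> [[a b] x] _; rewrite /upper_tail /=.
case: ifP => [/and3P[]|_]; last exact: measure_ge0.
rewrite !in_itv/= => /andP[a0 a1] /andP[b0 ba] /andP[x0 x1].
apply: uniform_ge_itv; first exact: measurable_xsection.
move=> y; rewrite /= in_itv/= => /andP[xy y1]; split; last first.
  by rewrite /= in_itv/= y1 (le_trans x0 (ltW xy)).
rewrite /= /xsection /= inE /assortative_event /=.
rewrite a0 a1 b0 (ltW (lt_le_trans ba a1)) x0 x1 (ltW (le_lt_trans x0 xy)) y1.
by rewrite ba.
Qed.

Lemma uniform4_identified_le (m : R) : 0 < m ->
  (uniform4 R (identified_event m) <= (24%:R^-1 + (6 * m)^-1)%:E)%E.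
Proof.
move=> m0; rewrite EFinD.
have [mF <-] := @integral_lower_gap R; have [mG <-] := integral_slack m0.
have mE := measurable_identified_event m.
have F0 z : 0 <= lower_gap z :> R.
  rewrite /lower_gap; case: ifP => // /and3P[_ _].
  by rewrite in_itv/= subr_ge0 => /andP[].
have G0 z : 0 <= slack m z.
  rewrite /slack; case: ifP => // /and3P[_ _].
  rewrite in_itv/= => /andP[_ xa].
  by rewrite mulr_ge0 ?subr_ge0// invr_ge0 ltW.
rewrite uniform4E -(ge0_integralD U3)//; last 4 first.
- by move=> z _; rewrite lee_fin; exact: F0.
- exact/measurable_EFinP.
- by move=> z _; rewrite lee_fin; exact: G0.
- exact/measurable_EFinP.
apply: ge0_le_integral => //.
- exact: measurable_section.
- by apply: emeasurable_funD; exact/measurable_EFinP.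
move=> [[a b] x] _.
have mS := measurable_xsection (a, b, x) mE.
rewrite -EFinD; have [|out] := boolP
  [&& 0 <= a <= 1, 0 <= b <= 1, 0 <= x <= 1, b < a & x < a].
  move=> /and5P[/andP[a0 a1] /andP[b0 b1] /andP[x0 x1] ba xa].
  (* Solving x + m y < a + m b for y gives this right end. *)
  apply: (le_trans (@uniform_le_itv _ _ x (b + (a - x) / m) mS _)).
    move=> y []; rewrite /= /xsection /= inE.
    move=> -[/= /and5P[_ _ _ _ /andP[_ xy]]] lt_y _.
    rewrite in_itv/= xy/= -lerBlDl ler_pdivlMr//.
    by rewrite mulrBl; lra.
  rewrite lee_fin ge_max addr_ge0//=.
  rewrite /slack /= !in_itv/= a0 a1 b0 b1 x0 (ltW xa)/=.
  (* The second summand is [slack]; the first is at most its positive part, which is [lower_gap]. *)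
  rewrite [leLHS](_ : _ = (b - x) + (a - x) / m); last by lra.
  rewrite lerD2r /lower_gap /= !in_itv/= a0 a1 b0 (ltW ba) x0/=.
  by case: (leP x b) => //= bx; rewrite subr_le0 ltW.
suff -> : xsection (identified_event m) (a, b, x) = set0.
  by rewrite measure0 lee_fin addr_ge0.
apply/seteqP; split=> // y; rewrite /= /xsection /= inE.
move=> -[/= /and5P[a01 b01 x01 _ /andP[ba xy]] lt_y].
(* Only [x < a] can fail. If [a <= x], then b < a <= x < y, so x + m y exceeds a + m b. *)
case/negP: out; rewrite a01 b01 x01 ba/= ltNge; apply/negP => ax.
have : m * b < m * y.
  by rewrite ltr_pM2l//; apply: (lt_trans ba); exact: le_lt_trans xy.
lra.
Qed.

(** The bound is 4 (1/24 + 1/(6m)), the quotient of the two previous estimates. *)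
Lemma cond_prob_identified_le (m : R) : 0 < m ->
  fine (uniform4 R (identified_event m)) / fine (uniform4 R assortative_event)
  <= 1 / 6 + 2 / (3 * m).
Proof.
move=> m0.
have finE (A : set (params R)) : measurable A -> uniform4 R A \is a fin_num.
  by move=> mA; exact: fin_num_measure.
have := uniform4_identified_le m0; have := uniform4_assortative_ge.
rewrite -[X in (_ <= X)%E -> _]fineK; last first.
  by apply: finE; exact: measurable_assortative_event.
rewrite -[X in _ -> (X <= _)%E -> _]fineK; last first.
  by apply: finE; exact: measurable_identified_event.
rewrite !lee_fin => PA PE.
have PA0 : 0 < fine (uniform4 R assortative_event).
  by apply: lt_le_trans PA; lra.
rewrite ler_pdivrMr//; apply: (le_trans PE).
have mV : 0 < m^-1 by rewrite invr_gt0.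
rewrite !invfM; set v := m^-1 in mV *; nra.
Qed.

End AssortativeProbability.

(** * Spectral criteria and volume bounds combined *)

Theorem corollary1 (R : realType) (k n c : nat) (cl : 'I_n -> 'I_k)
    (k_ge2 : (2 <= k)%N) (c_ge2 : (2 <= c)%N)
    (cl_size : forall i : 'I_k, #|cluster_set cl i| = c) :
  (forall pinP poutP pinM poutM : R,
     0 <= pinP <= 1 -> 0 <= poutP <= 1 -> 0 <= pinM <= 1 -> 0 <= poutM <= 1 ->
     poutP < pinP -> pinM < poutM ->
     smallest_eigenvectors (L_GM cl pinP poutP pinM poutM) (chi cl))
  /\
  (let assortative : set (params R) :=
     [set p | let: (pinP, poutP, pinM, poutM) := p in
        [/\ 0 <= pinP <= 1, 0 <= poutP <= 1, 0 <= pinM <= 1 & 0 <= poutM <= 1] /\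
        (poutP < pinP /\ pinM < poutM)] in
   let identified : set (params R) :=
     [set p | let: (pinP, poutP, pinM, poutM) := p in
        smallest_eigenvectors (L_SN cl pinP poutP pinM poutM) (chi cl) \/
        smallest_eigenvectors (L_BN cl pinP poutP pinM poutM) (chi cl)] in
   measurable (identified `&` assortative) /\
   cond_prob (uniform4 R) identified assortative
     <= 1 / 6 + 2 / (3 * (k%:R - 1)) + 1 / (k%:R - 1) ^+ 2).
Proof.
split=> [pinP poutP pinM poutM|assortative identified].
  move=> /andP[pinP0 _] /andP[poutP0 _] /andP[pinM0 _] /andP[poutM0 _].
  exact: (L_GM_smallest k_ge2 c_ge2 cl_size).
have assortativeE : assortative = assortative_event.
  apply/seteqP; split=> -[[[a b] x] y] /=.
    by move=> [[a01 b01 x01 y01] [ba xy]]; apply/and5P; split=> //; apply/andP.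
  by move=> /and5P[a01 b01 x01 y01 /andP[ba xy]]; split; split.
have identifiedE : identified `&` assortative = identified_event (k%:R - 1).
  rewrite assortativeE setIC.
  apply/seteqP; split=> -[[[a b] x] y] [pA pI]; split=> //;
    move: pA => /and5P[/= /andP[a0 _] /andP[b0 _] /andP[x0 _] /andP[y0 _]];
    move=> /andP[ba xy].
  - by case: pI => [/(L_SN_smallest k_ge2 c_ge2 cl_size)
                   |/(L_BN_smallest k_ge2 c_ge2 cl_size)]; exact.
  (* Both matrices have the same criterion, so either alternative may be chosen. *)
  - by left; apply/(L_SN_smallest k_ge2 c_ge2 cl_size).
rewrite /cond_prob identifiedE assortativeE.
split; first exact: measurable_identified_event.
have k1 : 0 < k%:R - 1 :> R by rewrite subr_gt0 ltr1n.
apply: (le_trans (cond_prob_identified_le k1)).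
(* The first two terms come from [cond_prob_identified_le]; the square term is nonnegative. *)
by rewrite lerDl divr_ge0// sqr_ge0.
Qed.
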